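(* Let $\sigma$ be a partition of a positive integer $r$, let $n,q$ be positive integers, let $H=H(n,r,q\mid\sigma)$, and let $\beta \geq \alpha \geq 2$ be integers with $\alpha \leq s(\sigma) \leq \beta$. Then the $(\alpha,\beta)$-monochromatic zone of $H$ is exactly the set of all integers $k$ with \[ \left\lceil \frac{ n-\left(s(\sigma)-1- (\alpha -1) \left\lfloor \frac{s(\sigma)-1}{\alpha -1} \right\rfloor\right) }{ \left\lfloor \frac{s(\sigma) - 1}{\alpha - 1} \right\rfloor } \right\rceil \leq k \leq n. \]
   Context: For a partition $\sigma$ of $r$ and positive integers $n,q$, the $\sigma$-hypergraph $H(n,r,q\mid\sigma)$ is the $r$-uniform hypergraph whose vertex set has $nq$ vertices partitioned into $n$ classes $V_1,\dots,V_n$ of $q$ vertices each, and in which an $r$-subset $K$ of the vertex set is an edge if and only if the multiset of non-zero cardinalities $|K\cap V_i|$, $1\le i\le n$, is exactly the partition $\sigma$. $s(\sigma)$ denotes the number of parts of $\sigma$. For integers $\alpha\le\beta$, an $(\alpha,\beta)$-colouring of a hypergraph is an assignment of colours to its vertices such that every edge contains at least $\alpha$ and at most $\beta$ distinct colours; a $k$-$(\alpha,\beta)$-colouring is one using exactly $k$ colours. The $(\alpha,\beta)$-monochromatic zone of a $\sigma$-hypergraph is the set of all integers $k$ for which there exists a $k$-$(\alpha,\beta)$-colouring in which every class $V_i$ is monochromatic (all its vertices receive the same colour).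
   Formalization: The hypergraph H is assumed to have at least one edge; without edges every colouring is vacuously valid and the claim fails, e.g. for σ=(2,1), n=2, q=1, α=β=2, where the zone is {1,2} but the formula gives only k=2. *)

(* Defs.v *)
From mathcomp Require Import all_boot all_order all_algebra.

Set Implicit Arguments.
Unset Strict Implicit.
Unset Printing Implicit Defensive.

Import Order.TTheory GRing.Theory Num.Theory.

Local Open Scope nat_scope.

(* Partitions are non-increasing sequences of positive parts, so that
   s(sigma), the number of parts, is [size sigma]. *)
Definition is_partition (r : nat) (sigma : seq nat) : bool :=
  [&& sorted geq sigma, 0 \notin sigma & sumn sigma == r].

Section Hypergraph.

Variables (n r q : nat) (sigma : seq nat).

(* The vertex (i, j) is the j-th vertex of the i-th class. *)
Definition vertex : finType := ('I_n * 'I_q)%type.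

Definition vclass (i : 'I_n) : {set vertex} := [set v | v.1 == i].

(* The multiset of non-zero cardinalities |K :&: V_i|, as a sequence up to
   permutation. *)
Definition part_sizes (K : {set vertex}) : seq nat :=
  [seq m <- [seq #|K :&: vclass i| | i : 'I_n] | m != 0].

Definition sigma_hypergraph : {set {set vertex}} :=
  [set K : {set vertex} | (#|K| == r) && perm_eq (part_sizes K) sigma].

End Hypergraph.

Arguments vclass {n q}.
Arguments part_sizes {n q}.

(* Colours are natural numbers; [ncolours c A] is the number of distinct
   colours occurring on A. *)
Definition ncolours (T : finType) (c : T -> nat) (A : {set T}) : nat :=
  size (undup [seq c x | x in A]).

Definition ab_colouring (T : finType) (E : {set {set T}}) (alpha beta : nat)
    (c : T -> nat) : Prop :=
  forall K : {set T}, K \in E -> alpha <= ncolours c K <= beta.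

Definition monochromatic_classes (n q : nat) (c : vertex n q -> nat) : Prop :=
  forall (i : 'I_n) (u v : vertex n q),
    u \in vclass i -> v \in vclass i -> c u = c v.

Definition monochromatic_zone (n r q : nat) (sigma : seq nat)
    (alpha beta : nat) (k : int) : Prop :=
  exists c : vertex n q -> nat,
    [/\ ab_colouring (sigma_hypergraph n r q sigma) alpha beta c,
        monochromatic_classes c
      & Posz (ncolours c [set: vertex n q]) = k].

(* Main.v *)
(** Since the parts of sigma are at most q, the traces of the edges on the set
    of classes are exactly the s-subsets, s = s(sigma).  A colouring of the
    classes is therefore admissible iff no alpha - 1 colours cover s classes.
    Write s - 1 = (alpha - 1) f + t by Euclidean division.  If the colouring is
    admissible, fewer than alpha - 1 colours are used more than f times;
    completing these to alpha - 1 colours, which cover at most s - 1 classes,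
    gives n <= k f + t.  Conversely, if n <= k f + t, the colouring of class i
    by i mod k is admissible: alpha - 1 colours cover at most (alpha - 1) f of
    the first k f classes and at most t of the others. *)
Require Import Defs.
From mathcomp Require Import all_boot all_order all_algebra.
From mathcomp Require Import zify.

Import Order.TTheory GRing.Theory Num.Theory.

(** * Counting colours *)

Lemma ncolours_le_size (T : finType) (c : T -> nat) (A : {set T})
    (U : seq nat) :
  (forall x, x \in A -> c x \in U) -> ncolours c A <= size U.
Proof.
move=> cU; apply: uniq_leq_size; first exact: undup_uniq.
by move=> y; rewrite mem_undup => /mapP[x]; rewrite mem_enum => /cU + ->.
Qed.

Lemma ncolours_le_card (T : finType) (c : T -> nat) (A : {set T}) :
  ncolours c A <= #|A|.
Proof. by rewrite /ncolours (leq_trans (size_undup _)) // size_map -cardE. Qed.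

(** Applied with [h] the projection of vertices to their classes, this moves the count from a vertex
    set to its trace. *)
Lemma ncolours_comp (T U : finType) (h : T -> U) (g : U -> nat) (A : {set T}) :
  ncolours (g \o h) A = ncolours g (h @: A).
Proof.
apply/perm_size/uniq_perm; rewrite ?undup_uniq // => y.
rewrite !mem_undup; apply/mapP/mapP => -[x].
  by rewrite mem_enum => xA ->; exists (h x); rewrite ?mem_enum ?imset_f.
by rewrite mem_enum => /imsetP[z zA ->] ->; exists z; rewrite ?mem_enum.
Qed.

Lemma eq_ncolours (T : finType) (c d : T -> nat) (A : {set T}) :
  c =1 d -> ncolours c A = ncolours d A.
Proof. by move=> cd; rewrite /ncolours /image_mem (eq_map cd). Qed.

Lemma card_preim_seq (T : finType) (g : T -> nat) (U : seq nat) : uniq U ->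
  #|[set i | g i \in U]| = \sum_(x <- U) #|[set i | g i == x]|.
Proof.
move=> uU.
transitivity (\sum_i (g i \in U : nat)).
  by rewrite -sum1dep_card big_mkcond; apply: eq_bigr => i _; case: (_ \in _).
under [RHS]eq_bigr => x _ do rewrite -sum1dep_card big_mkcond.
rewrite exchange_big; apply: eq_bigr => i _.
rewrite -(count_uniq_mem _ uU) -sum1_count big_mkcond.
by apply: eq_bigr => x _; rewrite /= eq_sym.
Qed.

Lemma sub_card_exists (T : finType) (A : {set T}) (m : nat) : m <= #|A| ->
  exists2 S : {set T}, S \subset A & #|S| = m.
Proof.
move=> mA; exists [set x in take m (enum A)].
  by apply/subsetP=> x; rewrite inE => /mem_take; rewrite mem_enum.
rewrite cardsE; have /card_uniqP-> := take_uniq m (enum_uniq A).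
by rewrite size_take -cardE; case: ltngtP mA.
Qed.

(** * Extremal bounds for colourings of the classes alone *)

Section ClassColourings.

Variables (n m b : nat).

Lemma ncolours_ge_colouring (g : 'I_n -> nat) :
  0 < b -> m < n -> (forall S : {set 'I_n}, #|S| = m.+1 -> b < ncolours g S) ->
  n <= ncolours g [set: 'I_n] * (m %/ b) + m %% b.
Proof.
move=> b_gt0 mn gS; set f := m %/ b.
(* Otherwise some [m.+1] of these classes would see at most [b] colours, against [gS]. *)
have few_colours (U : seq nat) : size U <= b -> #|[set i | g i \in U]| <= m.
  move=> Ub; rewrite leqNgt; apply/negP => /sub_card_exists[S sS cS].
  have := gS S cS; rewrite ltnNge; apply/negP/negPn.
  apply: leq_trans Ub; apply: ncolours_le_size => x /(subsetP sS).
  by rewrite inE.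
pose L := undup [seq g i | i in [set: 'I_n]].
have gL i : g i \in L by rewrite mem_undup map_f // mem_enum inE.
pose N x := #|[set i | g i == x]|.
pose P x := f < N x.
(* Colours used more than [f] times come first, so the first [b] entries either all are such colours
   or include every one of them. *)
pose L' := filter P L ++ filter (predC P) L.
have permL : perm_eq L' L by rewrite perm_filterC.
have gL' i : g i \in L' by rewrite (perm_mem permL).
have uL' : uniq L' by rewrite (perm_uniq permL) undup_uniq.
have sL' : size L' = ncolours g [set: 'I_n] by rewrite (perm_size permL).
(* All the colours together cover [n > m] classes. *)
have kb : b < size L'.
  rewrite ltnNge; apply/negP => /few_colours.
  have -> : [set i | g i \in L'] = [set: 'I_n].
    by apply/setP=> i; rewrite !inE gL'.
  by rewrite cardsT card_ord leqNgt mn.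
have nE : n = \sum_(x <- L') N x.
  rewrite -card_preim_seq // -[LHS]card_ord -cardsT.
  by apply/eq_card => i; rewrite !inE gL'.
have sizeT : size (take b L') = b by rewrite size_take kb.
have topE : \sum_(x <- take b L') N x <= m.
  by rewrite -card_preim_seq ?take_uniq // few_colours // sizeT.
(* Otherwise the first [b] colours would cover at least [b * f.+1 > m] classes. *)
have Pb : size (filter P L) <= b.
  rewrite leqNgt; apply/negP => bP.
  move: topE; rewrite leqNgt => /negP; apply.
  have le : \sum_(x <- take b L') f.+1 <= \sum_(x <- take b L') N x.
    rewrite big_seq [leqRHS]big_seq; apply: leq_sum => x.
    rewrite /L' take_cat bP => /mem_take.
    by rewrite mem_filter => /andP[].
  apply: leq_trans le; rewrite big_const_seq count_predT iter_addn_0 sizeT.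
  exact: ltn_ceil.
have restE : \sum_(x <- drop b L') N x <= (size L' - b) * f.
  rewrite -size_drop mulnC -iter_addn_0.
  rewrite -(count_predT (drop b L')) -big_const_seq.
  rewrite big_seq [leqRHS]big_seq; apply: leq_sum => x.
  rewrite /L' drop_cat ltnNge Pb /= => /mem_drop.
  by rewrite mem_filter /= /P -leqNgt => /andP[].
(* The first [b] colours cover at most [m = b * f + m %% b] classes, each other colour at most
   [f]. *)
rewrite {1}nE -{1}(cat_take_drop b L') big_cat /= -sL'.
rewrite -(subnKC (ltnW kb)) mulnDl addnAC leq_add //.
by rewrite [b * _]mulnC -divn_eq.
Qed.

Lemma mod_colouring (k : nat) (S : {set 'I_n}) : 0 < k ->
  n <= k * (m %/ b) + m %% b -> #|S| = m.+1 ->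
  b < ncolours (fun i : 'I_n => i %% k) S.
Proof.
move=> k0 nk cS; rewrite ltnNge; apply/negP => cb.
suff : #|S| <= m by rewrite cS ltnn.
pose L := undup [seq i %% k | i : 'I_n in S].
(* [W] contains [S]: an index below [k * (m %/ b)] is its residue plus fewer than [m %/ b] multiples
   of [k]; the larger ones fill at most [m %% b] places by the bound on [n]. *)
pose W := [seq x + y * k | x <- L, y <- iota 0 (m %/ b)]
          ++ iota (k * (m %/ b)) (m %% b).
have sW : size W <= m.
  rewrite size_cat size_allpairs !size_iota {3}(divn_eq m b) leq_add2r.
  by rewrite mulnC leq_mul2l cb orbT.
apply: leq_trans sW; rewrite cardE -(size_map val).
apply: uniq_leq_size; first by rewrite (map_inj_uniq val_inj) enum_uniq.
move=> _ /mapP[i iS ->]; rewrite mem_cat mem_iota.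
have [ik|ik] := leqP (k * (m %/ b)) (val i).
  by rewrite (leq_trans (ltn_ord i) nk) orbT.
apply/orP; left; apply/allpairsP; exists (i %% k, i %/ k); split => /=.
- by rewrite mem_undup; apply/mapP; exists i.
- by rewrite mem_iota /= ltn_divLR // mulnC.
- by rewrite addnC -divn_eq.
Qed.

Lemma ncolours_mod (k : nat) : 0 < k <= n ->
  ncolours (fun i : 'I_n => i %% k) [set: 'I_n] = k.
Proof.
move=> /andP[k0 kn]; rewrite -[RHS](size_iota 0).
apply/perm_size/uniq_perm; rewrite ?undup_uniq ?iota_uniq // => x.
rewrite mem_undup mem_iota; apply/mapP/idP => [[i _ ->]|/= xk].
  by rewrite ltn_mod.
exists (Ordinal (leq_trans xk kn)); first by rewrite mem_enum inE.
by rewrite modn_small.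
Qed.

End ClassColourings.

(** * Traces of vertex sets on the classes *)

Section Traces.

Variables (n q : nat).
Implicit Types (K : {set vertex n q}) (i : 'I_n).

Lemma mem_trace K i : (i \in [set v.1 | v in K]) = (#|K :&: vclass i| != 0).
Proof.
rewrite cards_eq0; apply/imsetP/set0Pn => [[v vK ->]|[v]].
  by exists v; rewrite !inE vK eqxx.
by rewrite !inE => /andP[vK /eqP <-]; exists v.
Qed.

Lemma card_trace K : #|[set v.1 | v in K]| = size (part_sizes K).
Proof.
rewrite /part_sizes filter_map size_map size_filter -sum1_count big_enum_cond.
by rewrite -sum1_card; apply: eq_bigl => i; rewrite mem_trace.
Qed.

End Traces.

(** * From rational floor and ceiling to Euclidean division *)

Section Arithmetic.

Local Open Scope ring_scope.

Lemma floor_natdiv (R : archiRealFieldType) (m d : nat) : (0 < d)%N ->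
  Num.floor (m%:R / d%:R : R) = (m %/ d)%N.
Proof.
move=> d0; apply: floor_def; have dR : 0 < d%:R :> R by rewrite ltr0n.
rewrite ler_pdivlMr // ltr_pdivrMr // -PoszD -!pmulrn -!natrM ler_nat ltr_nat.
by rewrite leq_divM /= addn1 ltn_ceil.
Qed.

(** As [b <= m], the floor [f] is at least 1, so the inequality can be multiplied by [f]; the
    corrective term [m - b * f] is the remainder. *)
Lemma ceil_bound_nat (n m b : nat) (k : int) : (0 < b <= m)%N -> (m < n)%N ->
  let f : rat := (Num.floor (m%:R / b%:R : rat))%:~R in
  (Num.ceil ((n%:R - (m%:R - b%:R * f)) / f) <= k) =
  (n%:Z <= k * (m %/ b)%N + (m %% b)%N).
Proof.
move=> /andP[b0 bm] mn f.
have fE : f = (m %/ b)%N%:R by rewrite /f floor_natdiv // -pmulrn.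
have f0 : 0 < f by rewrite fE ltr0n divn_gt0.
have tE : m%:R - b%:R * f = (m %% b)%N%:R.
  by rewrite fE {1}(divn_eq m b) natrD natrM mulrC addrAC subrr add0r.
rewrite ceil_le_int ler_pdivrMr // tE lerBlDr fE !pmulrn -intrM -intrD.
by rewrite ler_int.
Qed.

End Arithmetic.

(** * Edges with a prescribed trace *)

Section Edges.

Variables (n r q : nat) (sigma : seq nat).
Hypothesis sigma_part : is_partition r sigma.

Lemma edge_exists (S : {set 'I_n}) :
  sigma_hypergraph n r q sigma != set0 -> #|S| = size sigma ->
  exists2 K, K \in sigma_hypergraph n r q sigma & [set v.1 | v in K] = S.
Proof.
case/and3P: sigma_part => _ sigma0 /eqP sumE /set0Pn[K0].
rewrite inE => /andP[_ permK0] cS.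
(* Every part is the size of the intersection of [K0] with a class of [q] vertices. *)
have sigmaq x : x \in sigma -> x <= q.
  rewrite -(perm_mem permK0) mem_filter => /andP[_ /mapP[i _ ->]].
  have qE : #|[set (i, j) | j : 'I_q]| = q.
    by rewrite card_imset ?card_ord // => j k [].
  rewrite -[leqRHS]qE; apply/subset_leq_card/subsetP=> -[i' j].
  rewrite !inE => /andP[_ /eqP /= ->].
  by rewrite imset_f.
(* The parts are dealt out to [S] in the order of [enum S]; [K] takes the first [h i] vertices of
   each class [i] of [S]. *)
pose h i := nth 0 sigma (index i (enum S)).
have ltS i : i \in S -> index i (enum S) < size sigma.
  by move=> iS; rewrite -cS cardE index_mem mem_enum.
have hin i : i \in S -> h i \in sigma by move=> /ltS ?; rewrite mem_nth.
pose K : {set vertex n q} :=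
  [set v | (v.1 \in S) && ((v.2 : 'I_q) < h v.1)].
have trK i : #|K :&: vclass i| = if i \in S then h i else 0.
  case: ifPn => iS; last first.
    apply/eqP; rewrite cards_eq0; apply/eqP/setP => v; rewrite !inE.
    by apply/negbTE/negP => /andP[/andP[vS _] /eqP vi]; rewrite -vi vS in iS.
  have hq := sigmaq _ (hin i iS).
  have -> : K :&: vclass i = [set (i, widen_ord hq j) | j : 'I_(h i)].
    apply/setP => -[i' j]; rewrite !inE /=.
    apply/andP/imsetP => [[/andP[_ jh] /eqP ii]|[j' _ [-> ->]]].
      subst i'; exists (Ordinal jh) => //; congr pair; exact: val_inj.
    by rewrite iS /= ltn_ord.
  by rewrite card_imset ?card_ord // => j k [] /val_inj.
have psK : part_sizes K = sigma.
  rewrite /part_sizes /image_mem (eq_map trK) filter_map.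
  (* Parts are non-zero, so dropping empty intersections leaves exactly [S]. *)
  rewrite (@eq_filter _ _ (mem S)); last first.
    move=> i /=; case: ifP => // iS; apply: contraNneq sigma0 => <-.
    exact: hin.
  have -> : [seq i <- enum 'I_n | mem S i] = enum S.
    by rewrite enumT.
  apply: (@eq_from_nth _ 0) => [|k]; rewrite size_map -cardE // => kS.
  have i0 : 'I_n by case: (enum S) (cardE S) kS => [->|].
  rewrite (nth_map i0) -?cardE // /h -mem_enum mem_nth -?cardE //.
  by rewrite index_uniq ?enum_uniq -?cardE.
exists K; last first.
  apply/setP => i; rewrite mem_trace trK; case: ifP => // iS.
  by apply: contraNneq sigma0 => <-; apply: hin.
rewrite inE psK perm_refl andbT -sumE -psK.
have -> : sumn (part_sizes K) = sumn [seq #|K :&: vclass i| | i : 'I_n].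
  by rewrite /part_sizes; elim: (image_mem _ _) => //= -[|x] l /= ->.
rewrite sumnE big_map -sum1_card (partition_big fst predT) //= big_enum /=.
apply/eqP/eq_bigr => i _; rewrite -sum1_card; apply: eq_bigl => v.
by rewrite !inE.
Qed.

Lemma card_edge_trace K : K \in sigma_hypergraph n r q sigma ->
  #|[set v.1 | v in K]| = size sigma.
Proof. by rewrite inE card_trace => /andP[_ /perm_size]. Qed.

End Edges.

Local Open Scope ring_scope.

Theorem theorem3p1 (r n q : nat) (sigma : seq nat) (alpha beta : nat)
    (hr : (0 < r)%N) (hn : (0 < n)%N) (hq : (0 < q)%N)
    (hsigma : is_partition r sigma)
    (hedge : sigma_hypergraph n r q sigma != set0)
    (halpha : (2 <= alpha)%N) (halphabeta : (alpha <= beta)%N)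
    (hs : (alpha <= size sigma <= beta)%N) :
  forall k : int,
    monochromatic_zone n r q sigma alpha beta k <->
    let s : rat := (size sigma)%:R in
    let a : rat := alpha%:R in
    let f : rat := (Num.floor ((s - 1) / (a - 1)))%:~R in
    Num.ceil ((n%:R - (s - 1 - (a - 1) * f)) / f) <= k <= n%:Z.
Proof.
move=> k; case/andP: hs => alpha_s s_beta.
pose m := (size sigma).-1; pose b := alpha.-1.
have mE : size sigma = m.+1 by rewrite /m; lia.
have bE : alpha = b.+1 by rewrite /b; lia.
have b0 : (0 < b <= m)%N by lia.
have mn : (m < n)%N.
  case/set0Pn: hedge => K /card_edge_trace; rewrite -mE => <-.
  by rewrite -[leqRHS]card_ord max_card.
have s1 : (size sigma)%:R - 1 = m%:R :> rat by rewrite mE -natr1 addrK.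
have a1 : alpha%:R - 1 = b%:R :> rat by rewrite bE -natr1 addrK.
rewrite /= s1 a1 ceil_bound_nat //.
have trace_setT : [set v.1 | v in [set: vertex n q]] = [set: 'I_n].
  apply/setP => i; rewrite !inE; apply/imsetP.
  by exists (i, Ordinal hq).
split=> [[c [cE cmono <-]]|/andP[nk kn]].
  (* Vertex 0 represents its class, which is monochromatic. *)
  pose g i := c (i, Ordinal hq).
  have cg A : ncolours c A = ncolours g [set v.1 | v in A].
    rewrite -ncolours_comp; apply: eq_ncolours => v.
    by apply: (cmono v.1); rewrite !inE.
  have gS (S : {set 'I_n}) : #|S| = m.+1 -> (b < ncolours g S)%N.
    rewrite -mE => /(edge_exists _ _ _ _ hsigma _ hedge)[K /cE + <-].
    by rewrite -cg -bE => /andP[].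
  rewrite cg trace_setT lez_nat.
  have := ncolours_le_card _ g [set: 'I_n]; rewrite cardsT card_ord => ->.
  rewrite andbT -PoszM -PoszD lez_nat.
  by apply: ncolours_ge_colouring => //; case/andP: b0.
(* For [k <= 0] the lower bound would give [n <= m %% b <= m < n]. *)
have k0 : 0 < k.
  have : (m %% b <= m)%N by apply: leq_mod.
  nia.
case: k k0 kn nk => // k k0 kn nk.
pose g (i : 'I_n) := (i %% k)%N.
exists (g \o fst); split.
- move=> K KE; rewrite ncolours_comp; apply/andP; split.
    rewrite bE; apply: (mod_colouring _ m).
    + by [].
    + by move: nk; rewrite -PoszM -PoszD lez_nat.
    + by rewrite (card_edge_trace _ _ _ _ _ KE).
  (* An edge meets only [size sigma] classes, each of one colour. *)
  apply: leq_trans s_beta; apply: leq_trans (ncolours_le_card _ _ _) _.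
  by rewrite (card_edge_trace _ _ _ _ _ KE).
- by move=> i u v; rewrite !inE /= => /eqP -> /eqP ->.
- by rewrite ncolours_comp trace_setT ncolours_mod //; apply/andP.
Qed.
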